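(* Let $R$ be a ring (not necessarily unital) and $\phi:R\to R$ an automorphism. Assume $R$ is $H'$-unital. Then $R[t,\phi]$ and $R[t,t^{-1},\phi]$ are $H'$-unital rings.
   Context: For a ring $R$, $\tilde R=R\oplus\mathbb{Z}$ is its unitization. $R$ is $H'$-unital if $\mathrm{Tor}^{\tilde R}_n(R,\mathbb{Z})=0$ for all $n\ge 0$, where $\mathbb{Z}$ is an $\tilde R$-module via the augmentation $\tilde R\to\mathbb{Z}$. $R[t,\phi]$ is the twisted polynomial ring, whose elements are finite sums $\sum_{n\ge 0}r_nt^n$ with $r_n\in R$ and multiplication determined by $(at^m)(bt^n)=a\phi^m(b)t^{m+n}$; $R[t,t^{-1},\phi]$ is the twisted Laurent polynomial ring, defined in the same way with $m,n\in\mathbb{Z}$. *)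

(* Defs.v *)
From HB Require Import structures.
From mathcomp Require Import all_boot all_algebra.
From mathcomp Require Import boolp finmap.
From mathcomp.multinomials Require Import monalg.

Set Implicit Arguments.
Unset Strict Implicit.
Unset Printing Implicit Defensive.

Import GRing.Theory.
Local Open Scope ring_scope.

(* Associative rings, not necessarily unital nor commutative. *)
HB.mixin Record Zmodule_isRng R of GRing.Zmodule R := {
  rmul : R -> R -> R;
  rmulA : associative rmul;
  rmulDl : left_distributive rmul +%R;
  rmulDr : right_distributive rmul +%R
}.

#[short(type="rngType")]
HB.structure Definition Rng := { R of Zmodule_isRng R & GRing.Zmodule R }.

Notation "x ** y" := (rmul x y) (at level 40, left associativity) : ring_scope.

Section RngTheory.
Variable R : rngType.
Implicit Types x y : R.

Lemma rmulr_is_zmod_morphism x : zmod_morphism (fun y => x ** y).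
Proof.
by move=> y z /=; apply/eqP; rewrite eq_sym subr_eq -rmulDr subrK.
Qed.

Lemma rmull_is_zmod_morphism y : zmod_morphism (fun x => x ** y).
Proof.
by move=> x z /=; apply/eqP; rewrite eq_sym subr_eq -rmulDl subrK.
Qed.

HB.instance Definition _ x := GRing.isZmodMorphism.Build R R (rmul x)
  (rmulr_is_zmod_morphism x).

Definition rmulrev y x := x ** y.

HB.instance Definition _ y := GRing.isZmodMorphism.Build R R (rmulrev y)
  (rmull_is_zmod_morphism y).

Lemma rmul0 x : x ** 0 = 0. Proof. exact: (raddf0 (rmul x)). Qed.
Lemma rmul0l x : 0 ** x = 0. Proof. exact: (raddf0 (rmulrev x)). Qed.
Lemma rmulzr x y (n : int) : x ** (y *~ n) = (x ** y) *~ n.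
Proof. exact: (raddfMz (rmul x)). Qed.
Lemma rmulzl x y (n : int) : (x *~ n) ** y = (x ** y) *~ n.
Proof. exact: (raddfMz (rmulrev y)). Qed.
Lemma rmul_sumr x I (r : seq I) (F : I -> R) :
  x ** (\sum_(i <- r) F i) = \sum_(i <- r) x ** F i.
Proof. exact: (raddf_sum (rmul x)). Qed.
Lemma rmul_suml x I (r : seq I) (F : I -> R) :
  (\sum_(i <- r) F i) ** x = \sum_(i <- r) F i ** x.
Proof. exact: (raddf_sum (rmulrev x)). Qed.

End RngTheory.

Definition unitization (R : rngType) : Type := (R * int)%type.

Section Unitization.
Variable R : rngType.

HB.instance Definition _ := GRing.Zmodule.on (unitization R).

Definition unitz_one : unitization R := (0, 1).
Definition unitz_mul (a b : unitization R) : unitization R :=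
  (a.1 ** b.1 + b.1 *~ a.2 + a.1 *~ b.2, a.2 * b.2).

Fact unitz_mulA : associative unitz_mul.
Proof.
move=> [a m] [b n] [c p]; rewrite /unitz_mul /=; congr pair; last exact: mulrA.
rewrite !rmulDr !rmulDl rmulA !rmulzr !rmulzl !mulrzDl -!mulrzA.
rewrite (mulrC n m) (mulrC p m).
by rewrite [LHS](AC (3*3*1) (1*4*2*5*3*6*7)) !addrA.
Qed.

Fact unitz_mul1l : left_id unitz_one unitz_mul.
Proof.
by move=> [a m]; rewrite /unitz_mul /= rmul0l mul0rz add0r addr0 mulr1z mul1r.
Qed.

Fact unitz_mul1r : right_id unitz_one unitz_mul.
Proof.
by move=> [a m]; rewrite /unitz_mul /= rmul0 mul0rz !add0r mulr1z mulr1.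
Qed.

Fact unitz_mulDl : left_distributive unitz_mul +%R.
Proof.
move=> [a m] [b n] [c p]; congr pair => /=; last exact: mulrDl.
by rewrite rmulDl mulrzDr mulrzDl [LHS](AC (2*2*2) (1*3*5*2*4*6)) !addrA.
Qed.

Fact unitz_mulDr : right_distributive unitz_mul +%R.
Proof.
move=> [a m] [b n] [c p]; congr pair => /=; last exact: mulrDr.
by rewrite rmulDr mulrzDr mulrzDl [LHS](AC (2*2*2) (1*3*5*2*4*6)) !addrA.
Qed.

Fact unitz_1neq0 : unitz_one != 0.
Proof. by apply/eqP; case. Qed.

HB.instance Definition _ := GRing.Zmodule_isNzRing.Build (unitization R)
  unitz_mulA unitz_mul1l unitz_mul1r unitz_mulDl unitz_mulDr unitz_1neq0.

End Unitization.

(* R as the right ideal R (+) 0 of its unitization.  Right modules over S are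
   encoded as left modules over the converse ring S^c: s *: m stands for m s. *)
Definition right_self (R : rngType) : Type := R.

Section RightSelf.
Variable R : rngType.

HB.instance Definition _ := GRing.Zmodule.on (right_self R).

Definition right_self_scale (a : (unitization R)^c) (x : right_self R) :
  right_self R := (x : R) ** a.1 + x *~ a.2.

Fact right_self_scaleA a b x :
  right_self_scale a (right_self_scale b x) = right_self_scale (a * b) x.
Proof.
case: a b => [a m] [b n]; rewrite /right_self_scale /=.
rewrite rmulDl !rmulDr !rmulzr !rmulzl rmulA !mulrzDl -mulrzA.
by rewrite !addrA.
Qed.

Fact right_self_scale1 : left_id 1 right_self_scale.
Proof. by move=> x; rewrite /right_self_scale /= rmul0 add0r mulr1z. Qed.

Fact right_self_scaleDr : right_distributive right_self_scale +%R.
Proof.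
by move=> a x y; rewrite /right_self_scale rmulDl mulrzDl addrACA.
Qed.

Fact right_self_scaleDl x : {morph right_self_scale^~ x : a b / a + b}.
Proof.
by move=> a b; rewrite /right_self_scale /= rmulDr mulrzDr addrACA.
Qed.

HB.instance Definition _ := GRing.Zmodule_isLmodule.Build (unitization R)^c
  (right_self R) right_self_scaleA right_self_scale1
  right_self_scaleDr right_self_scaleDl.

End RightSelf.

(* The integers as a left module over the unitization, through (r, n) |-> n. *)
Definition aug_int (R : rngType) : Type := int.

Section AugInt.
Variable R : rngType.

HB.instance Definition _ := GRing.Zmodule.on (aug_int R).

Definition aug_int_scale (a : unitization R) (x : aug_int R) : aug_int R :=
  a.2 * (x : int).

Fact aug_int_scaleA a b x :
  aug_int_scale a (aug_int_scale b x) = aug_int_scale (a * b) x.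
Proof. exact: mulrA. Qed.

Fact aug_int_scale1 : left_id 1 aug_int_scale.
Proof. exact: mul1r. Qed.

Fact aug_int_scaleDr : right_distributive aug_int_scale +%R.
Proof. by move=> a x y; exact: mulrDr. Qed.

Fact aug_int_scaleDl x : {morph aug_int_scale^~ x : a b / a + b}.
Proof. by move=> a b; exact: mulrDl. Qed.

HB.instance Definition _ := GRing.Zmodule_isLmodule.Build (unitization R)
  (aug_int R) aug_int_scaleA aug_int_scale1 aug_int_scaleDr aug_int_scaleDl.

End AugInt.

(* {malg S[X]} is the free S-module on X, with basis the free_gen S x; free_lift
   is its universal property.  free_gen is locked because comparing two monomials
   << x >> and << y >> by conversion diverges when X is itself a free module. *)
HB.lock Definition free_gen (S : nzRingType) (X : choiceType) (x : X) :
  {malg S[X]} := << x >>.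
Arguments free_gen S {X} x.

Section FreeLift.
Variables (S : nzRingType) (X : choiceType) (M : lmodType S) (h : X -> M).

Definition free_lift (g : {malg S[X]}) : M := \sum_(x <- msupp g) g@_x *: h x.

Lemma free_liftEw (g : {malg S[X]}) (A : {fset X}) :
  (msupp g `<=` A)%fset -> free_lift g = \sum_(x <- A) g@_x *: h x.
Proof.
move=> gA; rewrite /free_lift (big_fset_incl _ gA) //= => x _.
by move/mcoeff_outdom ->; rewrite scale0r.
Qed.

Fact free_lift_is_linear : linear free_lift.
Proof.
move=> a g1 g2; pose A := (msupp g1 `|` msupp g2)%fset.
have s1 : (msupp g1 `<=` A)%fset by exact: fsubsetUl.
have s2 : (msupp g2 `<=` A)%fset by exact: fsubsetUr.
have s3 : (msupp (a *: g1 + g2) `<=` A)%fset.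
  apply: fsubset_trans (msuppD_le _ _) _; rewrite fsubUset s2 andbT.
  exact: fsubset_trans (msuppZ_le _ _) s1.
rewrite (free_liftEw s1) (free_liftEw s2) (free_liftEw s3).
rewrite scaler_sumr -big_split /=; apply: eq_bigr => x _.
by rewrite mcoeffD mcoeffZ scalerDl scalerA.
Qed.

HB.instance Definition _ := GRing.isLinear.Build S {malg S[X]} M *:%R free_lift
  free_lift_is_linear.

Lemma free_lift_gen (x : X) : free_lift (free_gen S x) = h x.
Proof.
rewrite unlock.
have := free_liftEw (msuppU_le (k := x) (x := 1)).
by rewrite big_seq_fset1 mcoeffUU scale1r.
Qed.

End FreeLift.

Lemma free_genE (S : nzRingType) (X : choiceType) (g : {malg S[X]}) :
  g = \sum_(x <- msupp g) g@_x *: free_gen S x.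
Proof.
rewrite {1}(monalgE g); apply: eq_bigr => x _; apply/malgP => y.
by rewrite unlock mcoeffZ !mcoeffU mulr_natr.
Qed.

Section Kernel.
Variables (U V : zmodType) (f : {additive U -> V}).

Definition ker_pred : {pred U} := [pred x | f x == 0].

Fact ker_pred_zmod_closed : zmod_closed ker_pred.
Proof.
split=> [|x y]; rewrite !inE ?raddf0 // raddfB => /eqP -> /eqP ->.
by rewrite subr0.
Qed.

HB.instance Definition _ := GRing.isZmodClosed.Build U ker_pred
  ker_pred_zmod_closed.

Record ker := Ker { ker_val : U; _ : ker_val \in ker_pred }.

HB.instance Definition _ := [isSub for ker_val].
HB.instance Definition _ := [Choice of ker by <:].
HB.instance Definition _ := [SubChoice_isSubZmodule of ker by <:].

End Kernel.

Section LinearKernel.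
Variables (S : nzRingType) (U V : lmodType S) (f : {linear U -> V}).

Fact ker_pred_scaler_closed : scaler_closed (ker_pred f).
Proof.
move=> a x; rewrite !inE => /eqP fx0; apply/eqP.
by transitivity (a *: f x); [exact: linearZ_LR | rewrite fx0 scaler0].
Qed.

HB.instance Definition _ := GRing.isScaleClosed.Build S U (ker_pred f)
  ker_pred_scaler_closed.
HB.instance Definition _ := [SubZmodule_isSubLmodule of ker f by <:].

End LinearKernel.

(* Quotient of A by the subgroup generated by X. *)
Section QuotientBy.
Variables (A : zmodType) (X : A -> Prop).

Inductive generated : A -> Prop :=
| Gen_in x : X x -> generated x
| Gen_0 : generated 0
| Gen_sub x y : generated x -> generated y -> generated (x - y).

Definition gen_pred : {pred A} := [pred x | `[< generated x >]].

Fact gen_pred_zmod_closed : zmod_closed gen_pred.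
Proof.
split=> [|x y]; first exact/asboolP/Gen_0.
by move=> /asboolP gx /asboolP gy; apply/asboolP/Gen_sub.
Qed.

HB.instance Definition _ := GRing.isZmodClosed.Build A gen_pred
  gen_pred_zmod_closed.

Definition quotient_by : zmodType := Quotient.quot gen_pred.

End QuotientBy.

(* The subquotient ker g / im f, for A -f-> B -g-> C. *)
Definition homology (A B C : zmodType) (f : {additive A -> B})
    (g : {additive B -> C}) : zmodType :=
  quotient_by (fun z : ker g => exists a, f a = \val z).

Section Tensor.
Variables (S : nzRingType) (M : lmodType S^c) (N : lmodType S).

Inductive tensor_rel : {malg int[(M * N)%type]} -> Prop :=
| Tensor_Dl m1 m2 n :
    tensor_rel (free_gen int (m1 + m2, n)
                - free_gen int (m1, n) - free_gen int (m2, n))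
| Tensor_Dr m n1 n2 :
    tensor_rel (free_gen int (m, n1 + n2)
                - free_gen int (m, n1) - free_gen int (m, n2))
| Tensor_bal (s : S) m n :
    tensor_rel (free_gen int ((s : S^c) *: m, n) - free_gen int (m, s *: n)).

Definition tensor : zmodType := quotient_by tensor_rel.

End Tensor.

Section TensorMap.
Variables (S : nzRingType) (M M' : lmodType S^c) (N : lmodType S).
Variable f : {linear M -> M'}.

Definition tensor_map_free :
    {malg int[(M * N)%type]} -> {malg int[(M' * N)%type]} :=
  free_lift (fun k : M * N => free_gen int (f k.1, k.2)).

HB.instance Definition _ := GRing.Linear.on tensor_map_free.

Lemma tensor_map_free_gen m n :
  tensor_map_free (free_gen int (m, n)) = free_gen int (f m, n).
Proof. exact: free_lift_gen. Qed.

Fact tensor_map_free_rel x : generated (@tensor_rel S M N) x ->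
  generated (@tensor_rel S M' N) (tensor_map_free x).
Proof.
elim=> {x} [x []| |x y _ gx _ gy].
- move=> m1 m2 n; apply: Gen_in; rewrite !raddfB /= !tensor_map_free_gen linearD.
  exact: Tensor_Dl.
- move=> m n1 n2; apply: Gen_in; rewrite !raddfB /= !tensor_map_free_gen.
  exact: Tensor_Dr.
- move=> s m n; apply: Gen_in; rewrite !raddfB /= !tensor_map_free_gen linearZ.
  exact: Tensor_bal.
- by rewrite raddf0; exact: Gen_0.
- by rewrite raddfB; exact: Gen_sub.
Qed.

Definition tensor_map (x : tensor M N) : tensor M' N :=
  \pi_(tensor M' N)%qT (tensor_map_free (repr x)).

Lemma tensor_map_pi x :
  tensor_map (\pi_(tensor M N)%qT x) = \pi_(tensor M' N)%qT (tensor_map_free x).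
Proof.
apply/eqP; rewrite -Quotient.idealrBE -raddfB.
apply/asboolP/tensor_map_free_rel/asboolP.
by rewrite -[X in is_true X]/(_ - _ \in gen_pred _) Quotient.idealrBE reprK.
Qed.

Fact tensor_map_is_zmod_morphism : zmod_morphism tensor_map.
Proof.
move=> x y; rewrite -[x]reprK -[y]reprK.
by rewrite -raddfB !tensor_map_pi !raddfB.
Qed.

HB.instance Definition _ := GRing.isZmodMorphism.Build (tensor M N) (tensor M' N)
  tensor_map tensor_map_is_zmod_morphism.

End TensorMap.

Arguments tensor_map {S M M'} N f.

(* The standard free resolution of M: the free module on the underlying set of
   M surjects onto M, and one iterates with the kernel of this surjection. *)
Section StandardResolution.
Variable S : nzRingType.

Definition free_cover (M : lmodType S) : {linear {malg S[M]} -> M} :=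
  free_lift (fun m : M => m).

Fixpoint syzygy (M : lmodType S) (n : nat) : lmodType S :=
  if n is n'.+1 then ker (free_cover (syzygy M n')) else M.

Definition std_res (M : lmodType S) (n : nat) : lmodType S := {malg S[syzygy M n]}.

Definition std_res_d (M : lmodType S) (n : nat) :
    {linear std_res M n.+1 -> std_res M n} :=
  \val \o free_cover (syzygy M n.+1).

Definition std_res_aug (M : lmodType S) : {linear std_res M 0 -> M} := free_cover M.

Lemma free_cover_surj (M : lmodType S) (m : M) : exists x, free_cover M x = m.
Proof. by exists (free_gen S m); exact: free_lift_gen. Qed.

Lemma std_res_exact0 (M : lmodType S) (x : std_res M 0) :
  std_res_aug M x = 0 <-> exists y, std_res_d M 0 y = x.
Proof.
split=> [x0|[y <-]]; last first.
  exact: (eqP (valP (free_cover (syzygy M 1) y))).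
have kx : x \in ker_pred (free_cover M) by apply/eqP.
have [y yE] := free_cover_surj (M := syzygy M 1) (Ker kx).
by exists y; rewrite /std_res_d /= yE.
Qed.

Lemma std_res_exact (M : lmodType S) n (x : std_res M n.+1) :
  std_res_d M n x = 0 <-> exists y, std_res_d M n.+1 y = x.
Proof.
split=> [x0|[y <-]]; last first.
  transitivity (\val (0 : syzygy M n.+1)); last exact: raddf0.
  exact: congr1 (eqP (valP (free_cover (syzygy M n.+2) y))).
have kx : x \in ker_pred (free_cover (syzygy M n.+1)).
  by apply/eqP/val_inj; rewrite raddf0.
have [y yE] := free_cover_surj (M := syzygy M n.+2) (Ker kx).
by exists y; rewrite /std_res_d /= yE.
Qed.

End StandardResolution.

Section Tor.
Variables (S : nzRingType) (M : lmodType S^c) (N : lmodType S).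

Definition Tor_complex_d (k : nat) :
    {additive tensor (std_res M k.+1) N -> tensor (std_res M k) N} :=
  tensor_map N (std_res_d M k).

Definition Tor (n : nat) : zmodType :=
  match n with
  | 0 => homology (Tor_complex_d 0)
           (\0 : {additive tensor (std_res M 0) N -> int})
  | k.+1 => homology (Tor_complex_d k.+1) (Tor_complex_d k)
  end.

End Tor.

Definition Hprime_unital (R : rngType) : Prop :=
  forall (n : nat) (x : Tor (right_self R) (aug_int R) n), x = 0.

Record rng_aut (R : rngType) := RngAut {
  aut_fun :> R -> R;
  aut_inv : R -> R;
  aut_funD : {morph aut_fun : x y / x + y};
  aut_funM : {morph aut_fun : x y / x ** y};
  aut_funK : cancel aut_fun aut_inv;
  aut_invK : cancel aut_inv aut_fun
}.

Definition aut_expn (R : rngType) (phi : rng_aut R) (m : nat) : R -> R :=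
  iter m phi.

Definition aut_expz (R : rngType) (phi : rng_aut R) (m : int) : R -> R :=
  match m with
  | Posz k => iter k phi
  | Negz k => iter k.+1 (aut_inv phi)
  end.

(* Finite sums \sum_m r_m t^m, m in E, with (a t^m) (b t^n) = a (act m b) t^(m+n);
   << a *g m >> is a t^m. *)
Section TwistedMul.
Variables (R : rngType) (E : nmodType) (act : E -> R -> R).
Implicit Types g h : {malg R[E]}.

Definition twisted_mul g h : {malg R[E]} :=
  \sum_(m <- msupp g) \sum_(n <- msupp h) << g@_m ** act m h@_n *g m + n >>.

Hypothesis actD : forall m, {morph act m : x y / x + y}.
Hypothesis actM : forall m, {morph act m : x y / x ** y}.
Hypothesis act_comp : forall m n x, act (m + n) x = act m (act n x).

Let act0 m : act m 0 = 0.
Proof. by apply: (addrI (act m 0)); rewrite -actD !addr0. Qed.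

Let twisted_mulEw g h (A B : {fset E}) :
  (msupp g `<=` A)%fset -> (msupp h `<=` B)%fset -> twisted_mul g h =
  \sum_(m <- A) \sum_(n <- B) << g@_m ** act m h@_n *g m + n >>.
Proof.
move=> gA hB; rewrite /twisted_mul (big_fset_incl _ gA) /=; last first.
  move=> m _ /mcoeff_outdom ->.
  by rewrite big1 // => n _; rewrite rmul0l monalgU0.
apply: eq_bigr => m _; rewrite (big_fset_incl _ hB) //= => n _.
by move/mcoeff_outdom ->; rewrite act0 rmul0 monalgU0.
Qed.

Fact twisted_mulDl : left_distributive twisted_mul +%R.
Proof.
move=> g1 g2 h; have s := msuppD_le g1 g2.
rewrite (twisted_mulEw s (fsubset_refl _)).
rewrite (twisted_mulEw (fsubsetUl _ (msupp g2)) (fsubset_refl _)).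
rewrite (twisted_mulEw (fsubsetUr (msupp g1) _) (fsubset_refl _)).
rewrite -big_split; apply: eq_bigr => m _; rewrite -big_split.
by apply: eq_bigr => n _; rewrite mcoeffD rmulDl monalgUD.
Qed.

Fact twisted_mulDr : right_distributive twisted_mul +%R.
Proof.
move=> g h1 h2; have s := msuppD_le h1 h2.
rewrite (twisted_mulEw (fsubset_refl _) s).
rewrite (twisted_mulEw (fsubset_refl _) (fsubsetUl _ (msupp h2))).
rewrite (twisted_mulEw (fsubset_refl _) (fsubsetUr (msupp h1) _)).
rewrite -big_split; apply: eq_bigr => m _; rewrite -big_split.
by apply: eq_bigr => n _; rewrite mcoeffD actD rmulDr monalgUD.
Qed.

Fact twisted_mulUU a m b n :
  twisted_mul << a *g m >> << b *g n >> = << a ** act m b *g m + n >>.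
Proof.
by rewrite (twisted_mulEw msuppU_le msuppU_le) !big_seq_fset1 !mcoeffUU.
Qed.

Fact twisted_mulA : associative twisted_mul.
Proof.
have mul0l x : twisted_mul 0 x = 0.
  by apply: (addrI (twisted_mul 0 x)); rewrite -twisted_mulDl !addr0.
have mul0r x : twisted_mul x 0 = 0.
  by apply: (addrI (twisted_mul x 0)); rewrite -twisted_mulDr !addr0.
have suml I (r : seq I) F x : twisted_mul (\sum_(i <- r) F i) x =
    \sum_(i <- r) twisted_mul (F i) x.
  by apply: (big_morph (fun g => twisted_mul g x)) => // g h; exact: twisted_mulDl.
have sumr I (r : seq I) F x : twisted_mul x (\sum_(i <- r) F i) =
    \sum_(i <- r) twisted_mul x (F i).
  by apply: (big_morph (twisted_mul x)) => // g h; exact: twisted_mulDr.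
clear mul0l mul0r; move: twisted_mulUU suml sumr.
move: twisted_mul => mul mulUU suml sumr f g h; rewrite (monalgE f) (monalgE g) (monalgE h).
rewrite !suml; apply: eq_bigr => m _.
rewrite sumr (sumr _ (msupp g)) suml; apply: eq_bigr => n _.
rewrite !sumr; apply: eq_bigr => p _.
by rewrite !mulUU actM act_comp rmulA addrA.
Qed.

End TwistedMul.

Definition twisted_poly (R : rngType) (phi : rng_aut R) : Type := {malg R[nat]}.
Definition twisted_laurent (R : rngType) (phi : rng_aut R) : Type :=
  {malg R[int]}.

Section TwistedPolynomials.
Variables (R : rngType) (phi : rng_aut R).

HB.instance Definition _ := GRing.Zmodule.on (twisted_poly phi).
HB.instance Definition _ := GRing.Zmodule.on (twisted_laurent phi).

Definition twisted_poly_mul : twisted_poly phi -> twisted_poly phi -> twisted_poly phi :=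
  twisted_mul (aut_expn phi).
Definition twisted_laurent_mul :
    twisted_laurent phi -> twisted_laurent phi -> twisted_laurent phi :=
  twisted_mul (aut_expz phi).

Let invD : {morph aut_inv phi : x y / x + y}.
Proof.
by move=> x y; apply: (can_inj (aut_funK phi)); rewrite aut_funD !aut_invK.
Qed.

Let invM : {morph aut_inv phi : x y / x ** y}.
Proof.
by move=> x y; apply: (can_inj (aut_funK phi)); rewrite aut_funM !aut_invK.
Qed.

Fact aut_expnD m : {morph aut_expn phi m : x y / x + y}.
Proof. by move=> x y; elim: m => //= m ->; rewrite aut_funD. Qed.

Fact aut_expnM m : {morph aut_expn phi m : x y / x ** y}.
Proof. by move=> x y; elim: m => //= m ->; rewrite aut_funM. Qed.

Fact aut_expn_comp m n x :
  aut_expn phi (m + n) x = aut_expn phi m (aut_expn phi n x).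
Proof. exact: iterD. Qed.

Let aut_expzS m x : aut_expz phi (m + 1) x = phi (aut_expz phi m x).
Proof.
case: m => [k|[|k]]; first by rewrite -PoszD addn1.
  by rewrite /= aut_invK.
rewrite (_ : Negz k.+1 + 1 = Negz k) ?[in RHS]/= ?aut_invK //.
by rewrite !NegzE -[in LHS]addn1 PoszD opprD subrK.
Qed.

Let aut_expzV m x : aut_expz phi (m - 1) x = aut_inv phi (aut_expz phi m x).
Proof. by rewrite -[in RHS](subrK 1 m) aut_expzS aut_funK. Qed.

Let aut_expz_ind (P : (R -> R) -> Prop) :
  P id -> (forall f, P f -> P (phi \o f)) ->
  (forall f, P f -> P (aut_inv phi \o f)) -> forall m, P (aut_expz phi m).
Proof.
move=> P0 PS PV [] m.
  by elim: m => // m; exact: PS.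
elim: m => [|m]; first exact: PV _ P0.
exact: PV.
Qed.

Fact aut_expzD m : {morph aut_expz phi m : x y / x + y}.
Proof.
apply: (aut_expz_ind (P := fun f => {morph f : x y / x + y})) => // f fD x y /=.
  by rewrite fD aut_funD.
by rewrite fD invD.
Qed.

Fact aut_expzM m : {morph aut_expz phi m : x y / x ** y}.
Proof.
apply: (aut_expz_ind (P := fun f => {morph f : x y / x ** y})) => // f fM x y /=.
  by rewrite fM aut_funM.
by rewrite fM invM.
Qed.

Fact aut_expz_comp m n x :
  aut_expz phi (m + n) x = aut_expz phi m (aut_expz phi n x).
Proof.
elim/int_rec: m => [|m IH|m IH]; first by rewrite add0r.
  by rewrite -addn1 PoszD addrAC !aut_expzS IH.
by rewrite -addn1 PoszD opprD addrAC !aut_expzV IH.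
Qed.

HB.instance Definition _ := Zmodule_isRng.Build (twisted_poly phi)
  (twisted_mulA aut_expnD aut_expnM aut_expn_comp : associative twisted_poly_mul)
  (twisted_mulDl aut_expnD) (twisted_mulDr aut_expnD).

HB.instance Definition _ := Zmodule_isRng.Build (twisted_laurent phi)
  (twisted_mulA aut_expzD aut_expzM aut_expz_comp :
     associative twisted_laurent_mul)
  (twisted_mulDl aut_expzD) (twisted_mulDr aut_expzD).

End TwistedPolynomials.

(* Main.v *)
From HB Require Import structures.
From mathcomp Require Import all_boot all_algebra.
From mathcomp Require Import boolp finmap.
From mathcomp.multinomials Require Import monalg.
Require Import Defs.

Set Implicit Arguments.
Unset Strict Implicit.
Unset Printing Implicit Defensive.

Import GRing.Theory.
Local Open Scope ring_scope.

(** Call a right module M over the unitization R~ acyclic when all the groups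
Tor_n(M, Z) vanish, so that R is H'-unital exactly when R itself is acyclic.
The theorem is an instance of a more general fact: if R is an H'-unital
subring of A and A is a direct sum of copies of R as a right R-module, then A
is H'-unital ([Hprime_unital_extension]).  Both twisted rings are of this kind:
the summand R t^m is twisted by phi^m as a right R-module, but a t^m |->
phi^-m(a) identifies it with R.

Suppose that A is acyclic over R.  The A-modules P such that P.A is acyclic
over R include A itself.  For such a P let F be a free A~-module with a
surjection F -> P, and let K be the kernel of F.A -> P.A.  Over R, the module
F.A is a direct sum of copies of A, hence acyclic, and so is K, being the
kernel of a surjection between acyclic modules.  Then K = K.R, whence
K = K.A.  If N denotes the kernel of F -> P, then K is the intersection of N
and F.A, so it contains N.A, and it equals N.A since K = K.A.  The
equality of N.A with the intersection of N and F.A is the vanishing of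
Tor_1(P, Z) over A, and N again belongs to the class, since N.A = K is acyclic
over R.  Induction along a free resolution of A gives the vanishing of all its
Tor groups ([restrict_syzygy], [acyclic_change_of_rings]).

Acyclicity is handled without tensor products: for a right module M the group
M (x) Z is M / M.R, so the vanishing of Tor becomes a statement on sums of
elements s m with s of augmentation 0 ([Hprime_unitalP]).  In this form the
closure properties used above are proved directly: independence of the
resolution ([retract_tight]), kernels of surjections ([acyclic_sub]) and direct
sums ([acyclic_direct_sum]). *)

(** * Building and factoring linear maps *)

Section MakeAdditive.
Variables (U V : zmodType) (f : U -> V).
(** Carries the proof of additivity, so that the instance below applies. *)
Definition additive_fun (_ : zmod_morphism f) : U -> V := f.
Hypothesis f_add : zmod_morphism f.
HB.instance Definition _ :=
  GRing.isZmodMorphism.Build U V (additive_fun f_add) f_add.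
Definition make_additive : {additive U -> V} := additive_fun f_add.
Lemma make_additiveE x : make_additive x = f x. Proof. by []. Qed.
End MakeAdditive.

Section MakeLinear.
Variables (S : nzRingType) (M N : lmodType S) (f : M -> N).
(** Carries the proof of linearity, so that the instance below applies. *)
Definition linear_fun (_ : linear f) : M -> N := f.
Hypothesis f_lin : linear f.
HB.instance Definition _ :=
  GRing.isLinear.Build S M N *:%R (linear_fun f_lin) f_lin.
Definition make_linear : {linear M -> N} := linear_fun f_lin.
Lemma make_linearE x : make_linear x = f x. Proof. by []. Qed.
End MakeLinear.

Section Injections.
Variables (S : nzRingType) (M N : lmodType S).

Fact inj_left_linear : linear (fun x : M => (x, 0 : N)).
Proof. by move=> a x y; congr pair; rewrite /= scaler0 addr0. Qed.

Fact inj_right_linear : linear (fun y : N => (0 : M, y)).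
Proof. by move=> a x y; congr pair; rewrite /= scaler0 addr0. Qed.

Definition inj_left : {linear M -> (M * N)%type} := make_linear inj_left_linear.
Definition inj_right : {linear N -> (M * N)%type} := make_linear inj_right_linear.

Lemma inj_leftE x : inj_left x = (x, 0). Proof. by []. Qed.
Lemma inj_rightE y : inj_right y = (0, y). Proof. by []. Qed.

End Injections.
Arguments inj_left {S M N}.
Arguments inj_right {S M N}.

Section Factor.
Variables (S : nzRingType) (K M Q : lmodType S).
Variables (i : {linear K -> M}) (h : {linear Q -> M}).

Lemma factor_through : injective i -> (forall x, exists k, i k = h x) ->
  exists c : {linear Q -> K}, forall x, i (c x) = h x.
Proof.
move=> i_inj /choice [c cE].
have c_lin : linear c.
  by move=> a x y; apply: i_inj; rewrite cE !linearP !cE.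
by exists (make_linear c_lin).
Qed.
End Factor.

Section FactorKernel.
Variables (S : nzRingType) (U V N : lmodType S) (f : {linear U -> V}).

Lemma ker_valK (x : ker f) : f (\val x) = 0.
Proof. exact: (eqP (valP x)). Qed.

Lemma factor_ker (t : {linear N -> U}) : (forall x, f (t x) = 0) ->
  exists c : {linear N -> ker f}, forall x, \val (c x) = t x.
Proof.
move=> t0; apply: factor_through => [|x]; first exact: val_inj.
have kx : t x \in ker_pred f by exact/eqP/t0.
by exists (Ker kx).
Qed.

End FactorKernel.

(** * Acyclic modules *)

Section Decomposable.
Variables (S : nzRingType) (I : S -> Prop).

(** For the augmentation ideal I of a unitization, the decomposable elements of M
form the subgroup M.R by which M is divided in M (x) Z. *)
Inductive decomposable (M : lmodType S) : M -> Prop :=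
| decomposable0 : decomposable 0
| decomposable_cons s m x :
    I s -> decomposable x -> decomposable (s *: m + x).

Lemma decomposableZ (M : lmodType S) s (m : M) : I s -> decomposable (s *: m).
Proof. by move=> Is; rewrite -[_ *: _]addr0; constructor=> //; constructor. Qed.

Lemma decomposableD (M : lmodType S) (x y : M) :
  decomposable x -> decomposable y -> decomposable (x + y).
Proof.
elim=> [|s m {}x Is _ IH dy]; first by rewrite add0r.
by rewrite -addrA; constructor=> //; exact: IH.
Qed.

Lemma decomposableN (M : lmodType S) (x : M) :
  decomposable x -> decomposable (- x).
Proof.
elim=> [|s m {}x Is _ IH]; first by rewrite oppr0; constructor.
by rewrite opprD -scalerN; constructor.
Qed.

Lemma decomposable_linear (M N : lmodType S) (f : {linear M -> N}) x :
  decomposable x -> decomposable (f x).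
Proof.
elim=> [|s m {}x Is _ IH]; first by rewrite linear0; constructor.
by rewrite linearP; constructor.
Qed.

Lemma decomposable_lift (P M : lmodType S) (f : {linear P -> M}) m :
  (forall y, exists x, f x = y) -> decomposable m ->
  exists2 w, decomposable w & f w = m.
Proof.
move=> f_surj; elim=> [|s {}m x Is _ [w dw <-]].
  by exists 0; [constructor | rewrite linear0].
have [v vE] := f_surj m.
by exists (s *: v + w); [constructor | rewrite linearP vE].
Qed.

(** With K the kernel of f, this says that K / I.K -> P / I.P is injective.  When I
is an ideal, P is free and f is onto, it is the vanishing of Tor_1(S/I, M). *)
Definition tight (P M : lmodType S) (f : {linear P -> M}) :=
  forall z : ker f, decomposable (\val z) -> decomposable z.

(** By dimension shifting, Tor_(i+1) of M is Tor_1 of its i-th syzygy, so that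
this is the vanishing of Tor_1, ..., Tor_n. *)
Definition acyclic_upto n (M : lmodType S) :=
  forall i, (i < n)%N -> tight (free_cover (syzygy M i)).

Definition acyclic (M : lmodType S) :=
  (forall x : M, decomposable x) /\ forall n, acyclic_upto n M.

Lemma syzygyS (M : lmodType S) n :
  syzygy M n.+1 = syzygy (ker (free_cover M)) n.
Proof.
elim: n => // n IH.
exact: (congr1 (fun N : lmodType S => ker (free_cover N) : lmodType S) IH).
Qed.

Lemma acyclic_uptoS n (M : lmodType S) : acyclic_upto n.+1 M <->
  tight (free_cover M) /\ acyclic_upto n (ker (free_cover M)).
Proof.
split=> [aM|[t aM] [|i]]; last 1 first.
- by rewrite ltnS => /aM; rewrite syzygyS.
- split=> [|i ltin]; first exact: (aM 0%N).
  by rewrite -syzygyS; exact: aM.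
- by [].
Qed.

Definition projective (P : lmodType S) :=
  forall (M N : lmodType S) (p : {linear M -> N}) (f : {linear P -> N}),
  (forall n, exists m, p m = n) ->
  exists g : {linear P -> M}, forall x, p (g x) = f x.

Lemma free_ext (X : choiceType) (M : lmodType S) (f g : {linear {malg S[X]} -> M}) :
  (forall x, f (free_gen S x) = g (free_gen S x)) -> f =1 g.
Proof.
move=> fg w; rewrite (free_genE w) !linear_sum; apply: eq_bigr => x _.
by rewrite !linearZ fg.
Qed.

Lemma projective_free (X : choiceType) : projective {malg S[X]}.
Proof.
move=> M N p f /choice [s sE].
exists (free_lift (fun x => s (f (free_gen S x)))) => w.
apply: (free_ext (f := p \o free_lift _)) w => x.
by rewrite [LHS]/= free_lift_gen sE.
Qed.

Lemma projective_prod (P Q : lmodType S) :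
  projective P -> projective Q -> projective (P * Q)%type.
Proof.
move=> projP projQ M N p f p_surj.
have [g1 g1E] := projP _ _ p (f \o inj_left) p_surj.
have [g2 g2E] := projQ _ _ p (f \o inj_right) p_surj.
exists ((g1 \o fst) \+ (g2 \o snd)) => -[x y].
rewrite linearD [p (_ x)]g1E [p (_ y)]g2E /= -linearD.
by congr (f (_, _)); rewrite ?add0r ?addr0.
Qed.

(** Schanuel's lemma compares two syzygies only up to projective summands; being a
retract up to such a summand is the one-sided form of this comparison, and it is
stable under taking syzygies. *)
Definition retract (M' M : lmodType S) :=
  exists (P : lmodType S) (i : {linear M' -> (M * P)%type})
    (p : {linear (M * P)%type -> M'}), projective P /\ cancel i p.

Lemma retract_refl M : retract M M.
Proof.
exists {malg S[M]}.
by exists inj_left, fst; split; first exact: projective_free.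
Qed.

(** For Z projective and M' a retract of M * Z, lift the inclusion to
alpha : Q -> P * Z and the retraction to
beta : P * Z -> Q.  Then 1 - beta alpha maps Q into ker h, and adding it to the
composite of the maps induced on the kernels by alpha and beta gives the
identity of ker h. *)
Lemma retract_kernel (M M' P Q : lmodType S) (f : {linear P -> M})
    (h : {linear Q -> M'}) :
  retract M' M -> projective P -> (forall m, exists x, f x = m) ->
  projective Q -> (forall m, exists x, h x = m) ->
  exists (a : {linear ker h -> ker f}) (b : {linear ker f -> ker h})
    (c : {linear Q -> ker h}) (a' : {linear Q -> P}),
    (forall x, \val (a x) = a' (\val x)) /\ forall x, b (a x) + c (\val x) = x.
Proof.
move=> [Z [i [p [projZ ipK]]]] projP f_surj projQ h_surj.
pose fZ : P * Z -> M * Z := fun x => (f x.1, x.2).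
have fZ_lin : linear fZ by move=> k x y; rewrite /fZ linearP.
pose F := make_linear fZ_lin.
have [m|alpha alphaE] := projQ _ _ F (i \o h).
  have [x xE] := f_surj m.1; exists (x, m.2).
  by rewrite make_linearE /fZ /= xE; case: m {xE}.
have [beta betaE] := projective_prod projP projZ (p \o F) h_surj.
have val0 : forall x : ker h, F (alpha (\val x)) = 0.
  by move=> x; rewrite alphaE /= ker_valK linear0.
have [a aE] := factor_ker (f := f) (t := (fst \o alpha) \o \val)
  (fun x => congr1 fst (val0 x)).
have b0 (y : ker f) : h (beta (inj_left (\val y))) = 0.
  by rewrite betaE /= inj_leftE make_linearE /fZ /= [f _]ker_valK; exact: linear0.
have [b bE] := factor_ker (f := h) (t := (beta \o inj_left) \o \val) b0.
have cl : linear (fun w => w - beta (alpha w)).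
  by move=> k x y; rewrite (linearP alpha) (linearP beta) scalerBr opprD addrACA.
have c0 w : h (make_linear cl w) = 0.
  by rewrite make_linearE (linearB h) betaE /= alphaE /= ipK; exact: subrr.
have [c cE] := factor_ker (f := h) (t := make_linear cl) c0.
exists a, b, c, (fst \o alpha); split=> // x.
apply: val_inj; rewrite raddfD /= bE cE /= [ker_val (a x)]aE.
rewrite inj_leftE (_ : (_, 0) = alpha (\val x)) ?subrKC //.
by rewrite [RHS]surjective_pairing; congr pair; exact/esym/(congr1 snd (val0 x)).
Qed.

Lemma retract_tight (M M' P Q : lmodType S) (f : {linear P -> M})
    (h : {linear Q -> M'}) :
  retract M' M -> projective P -> (forall m, exists x, f x = m) ->
  projective Q -> (forall m, exists x, h x = m) ->
  (tight f -> tight h) /\ retract (ker h) (ker f).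
Proof.
move=> rM projP f_surj projQ h_surj.
have [a [b [c [a' [aE abc]]]]] := retract_kernel rM projP f_surj projQ h_surj.
split=> [tf x dx|].
  rewrite -[x]abc; apply: decomposableD; last exact: decomposable_linear.
  by apply/decomposable_linear/tf; rewrite aE; exact: decomposable_linear.
have il : linear (fun x => (a x, \val x : Q)).
  by move=> k x y; rewrite !linearP.
by exists Q, (make_linear il), ((b \o fst) \+ (c \o snd)).
Qed.

Lemma acyclic_upto_retract n M M' :
  retract M' M -> acyclic_upto n M -> acyclic_upto n M'.
Proof.
elim: n M M' => [//|n IH] M M' rM /acyclic_uptoS [tM aM]; apply/acyclic_uptoS.
have [tt rk] := retract_tight rM (@projective_free M) (@free_cover_surj S M)
  (@projective_free M') (@free_cover_surj S M').
by split; [exact: tt | exact: IH rk aM].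
Qed.

(** The vanishing of Tor may be tested on any projective cover. *)
Lemma acyclic_upto_cover n (P M : lmodType S) (f : {linear P -> M}) :
  projective P -> (forall m, exists x, f x = m) ->
  acyclic_upto n.+1 M <-> tight f /\ acyclic_upto n (ker f).
Proof.
move=> projP f_surj.
have [t1 r1] := retract_tight (retract_refl M) projP f_surj
  (@projective_free M) (@free_cover_surj S M).
have [t2 r2] := retract_tight (retract_refl M)
  (@projective_free M) (@free_cover_surj S M) projP f_surj.
rewrite acyclic_uptoS; split=> -[t a]; split.
- exact: t2.
- exact: acyclic_upto_retract a.
- exact: t1.
- exact: acyclic_upto_retract a.
Qed.

Lemma retract_section (M M' : lmodType S) (i : {linear M' -> M})
    (p : {linear M -> M'}) : cancel i p -> retract M' M.
Proof.
move=> ipK; exists {malg S[M]}, (inj_left \o i), (p \o fst).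
by split=> [|x]; [exact: projective_free | exact: ipK].
Qed.

(** The product of the covers of M and N is a projective cover of M * N whose
kernel is the product of the two kernels. *)
Lemma acyclic_upto_prod n (M N : lmodType S) :
  acyclic_upto n M -> acyclic_upto n N -> acyclic_upto n (M * N)%type.
Proof.
elim: n M N => [//|n IH] M N /acyclic_uptoS [tM aM] /acyclic_uptoS [tN aN].
pose cM := free_cover M; pose cN := free_cover N.
pose c (w : {malg S[M]} * {malg S[N]}) := (cM w.1, cN w.2).
have c_lin : linear c by move=> k x y; rewrite /c !linearP.
have [p1 p1E] : exists p : {linear ker (make_linear c_lin) -> ker cM},
    forall x, \val (p x) = (\val x).1.
  apply: (factor_ker (t := fst \o \val)) => x.
  exact: (congr1 fst (ker_valK x)).
have [p2 p2E] : exists p : {linear ker (make_linear c_lin) -> ker cN},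
    forall x, \val (p x) = (\val x).2.
  apply: (factor_ker (t := snd \o \val)) => x.
  exact: (congr1 snd (ker_valK x)).
have [i1 i1E] : exists i : {linear ker cM -> ker (make_linear c_lin)},
    forall x, \val (i x) = (\val x, 0).
  apply: (factor_ker (t := inj_left \o \val)) => x.
  by rewrite make_linearE /= inj_leftE /c /= [cM _]ker_valK linear0.
have [i2 i2E] : exists i : {linear ker cN -> ker (make_linear c_lin)},
    forall x, \val (i x) = (0, \val x).
  apply: (factor_ker (t := inj_right \o \val)) => x.
  by rewrite make_linearE /= inj_rightE /c /= [cN _]ker_valK linear0.
have pK x : i1 (p1 x) + i2 (p2 x) = x.
  apply: val_inj; rewrite raddfD /= [ker_val (i1 _)]i1E [ker_val (i2 _)]i2E.
  rewrite p1E p2E [RHS]surjective_pairing.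
  by congr pair; [exact: addr0 | exact: add0r].
apply/(@acyclic_upto_cover n _ _ (make_linear c_lin)).
- by apply: projective_prod; exact: projective_free.
- move=> [x y]; have [x' x'E] := free_cover_surj x.
  have [y' y'E] := free_cover_surj y.
  by exists (x', y'); rewrite make_linearE /c /= x'E y'E.
split=> [z dz|].
  rewrite -[z]pK; apply: decomposableD; apply: decomposable_linear.
    by apply: tM; rewrite p1E; exact: (decomposable_linear fst).
  by apply: tN; rewrite p2E; exact: (decomposable_linear snd).
apply: acyclic_upto_retract (IH _ _ aM aN).
have i_lin : linear (fun x => (p1 x, p2 x)) by move=> k x y; rewrite !linearP.
exact: (retract_section (i := make_linear i_lin)
  (p := (i1 \o fst) \+ (i2 \o snd)) pK).
Qed.

(** This is the exactness of Tor_1(N) -> K/I.K -> M/I.M.  Write i k as a sum of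
terms s m, and lift the images p m through f to elements v of P.  The sum of the
s v lies in ker f, hence is decomposable there, and it accounts for i k up to
the terms s (m - g v), where m - g v comes from K. *)
Lemma decomposable_sub (K M N P : lmodType S) (i : {linear K -> M})
    (p : {linear M -> N}) (f : {linear P -> N}) :
  injective i -> (forall x, p x = 0 <-> exists k, i k = x) ->
  (forall y, exists x, p x = y) -> (forall y, exists x, f x = y) ->
  projective P -> tight f ->
  forall k, decomposable (i k) -> decomposable k.
Proof.
move=> i_inj ex p_surj f_surj projP tf k dk.
have [g gE] := projP _ _ p f p_surj.
have [w [k' [dw dk' fw mE]]] : exists w k', [/\ decomposable w, decomposable k',
    f w = p (i k) & i k = g w + i k'].
  elim: dk => [|s m x Is _ [w [k' [dw dk' fw mE]]]].
    by exists 0, 0; split; rewrite ?linear0 ?addr0 //; constructor.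
  have [v vE] := f_surj (p m).
  have [k'' k''E] : exists k'', i k'' = m - g v.
    by apply/ex; rewrite linearB gE vE subrr.
  exists (s *: v + w), (s *: k'' + k'); split; rewrite ?linearP.
  - by constructor.
  - by constructor.
  - by rewrite vE fw.
  - by rewrite k''E mE scalerBr [RHS]addrACA subrKC.
have pik : p (i k) = 0 by apply/ex; exists k.
have [c cE] : exists c : {linear ker f -> K}, forall z, i (c z) = g (\val z).
  apply: (factor_through (h := g \o \val)) => // z.
  by apply/ex; rewrite /= gE [f _]ker_valK.
have kw : w \in ker_pred f by apply/eqP; rewrite -pik -fw.
have -> : k = c (Ker kw) + k' by apply: i_inj; rewrite linearD cE.
by apply: decomposableD => //; apply/decomposable_linear/tf.
Qed.

(** Horseshoe: covering M by the sum of the covers of K and M, and N by that of M,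
makes the syzygy of K the kernel of a surjection between syzygies of M and N. *)
Lemma acyclic_upto_sub n (K M N : lmodType S) (i : {linear K -> M})
    (p : {linear M -> N}) :
  injective i -> (forall x, p x = 0 <-> exists k, i k = x) ->
  (forall y, exists x, p x = y) ->
  acyclic_upto n M -> acyclic_upto n.+1 N -> acyclic_upto n K.
Proof.
elim: n K M N i p => [//|n IH] K M N i p i_inj ex p_surj aM aN.
pose cK := free_cover K; pose cM := free_cover M.
pose fM : {linear ({malg S[K]} * {malg S[M]})%type -> M} :=
  ((i \o cK) \o fst) \+ (cM \o snd).
pose fN := p \o cM.
have fM_surj m : exists x, fM x = m.
  have [x xE] := free_cover_surj m; exists (0, x).
  by rewrite /fM /= !linear0 add0r.
have fN_surj y : exists x, fN x = y.
  have [m mE] := p_surj y; have [x xE] := free_cover_surj m; exists x.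
  by rewrite /fN /= xE.
have [tM aKM] := (acyclic_upto_cover n
  (projective_prod (@projective_free K) (@projective_free M)) fM_surj).1 aM.
have [tN aKN] := (acyclic_upto_cover n.+1 (@projective_free M) fN_surj).1 aN.
have [j jE] : exists j : {linear ker cK -> ker fM},
    forall x, \val (j x) = (\val x, 0).
  apply: (factor_ker (t := inj_left \o \val)) => x.
  by rewrite /fM /= [cK _]ker_valK !linear0 addr0.
have [q qE] : exists q : {linear ker fM -> ker fN}, forall x, \val (q x) = (\val x).2.
  apply: (factor_ker (t := snd \o \val)) => x.
  have := congr1 p (ker_valK x); rewrite /fM /= linearD linear0.
  have -> : p (i (cK (\val x).1)) = 0 by apply/ex; eexists.
  by rewrite add0r.
have j_inj : injective j.
  by move=> x y /(congr1 val); rewrite !jE => -[] /val_inj.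
have jq x : q x = 0 <-> exists k, j k = x.
  split=> [qx0|[k <-]]; last by apply: val_inj; rewrite qE jE linear0.
  have x2 : (\val x).2 = 0 by rewrite -qE qx0 linear0.
  have kx : (\val x).1 \in ker_pred cK.
    apply/eqP/i_inj; have := ker_valK x.
    by rewrite /fM /= x2 !linear0 addr0.
  exists (Ker kx); apply: val_inj; rewrite jE [RHS]surjective_pairing.
  by rewrite x2.
have q_surj y : exists x, q x = y.
  have [k kE] : exists k, i k = cM (\val y) by apply/ex; exact: (ker_valK y).
  have [x xE] := free_cover_surj k.
  have kx : (- x, \val y) \in ker_pred fM.
    by apply/eqP; rewrite /fM /= !linearN xE kE addNr.
  by exists (Ker kx); apply: val_inj; rewrite qE.
apply/acyclic_uptoS; split; last exact: IH j_inj jq q_surj aKM aKN.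
have [tKN _] := (acyclic_uptoS n _).1 aKN.
move=> z dz; apply: (decomposable_sub j_inj jq q_surj (@free_cover_surj S _)
  (@projective_free _) tKN).
by apply: tM; rewrite jE; exact: (decomposable_linear inj_left).
Qed.

Lemma acyclic_sub (K M N : lmodType S) (i : {linear K -> M})
    (p : {linear M -> N}) :
  injective i -> (forall x, p x = 0 <-> exists k, i k = x) ->
  (forall y, exists x, p x = y) -> acyclic M -> acyclic N -> acyclic K.
Proof.
move=> i_inj ex p_surj [dM aM] [dN aN]; split=> [k|n]; last first.
  exact: acyclic_upto_sub i_inj ex p_surj (aM n) (aN n.+1).
have [tN _] := (acyclic_uptoS 0 _).1 (aN 1%N).
exact: (decomposable_sub i_inj ex p_surj (@free_cover_surj S _)
  (@projective_free _) tN) (dM _).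
Qed.

(** Tor commutes with filtered colimits.  The instance needed for infinite direct
sums is the one where every finite set of elements is fixed by an endomorphism
that factors through an acyclic module. *)
Definition locally_acyclic_upto n (Q : lmodType S) :=
  forall s : seq Q, exists (M : lmodType S) (u : {linear Q -> M})
    (v : {linear M -> Q}), acyclic_upto n M /\ {in s, cancel u v}.

Definition free_map (M N : lmodType S) (u : {linear M -> N}) :
    {linear {malg S[M]} -> {malg S[N]}} :=
  free_lift (fun m => free_gen S (u m)).

Lemma free_map_gen (M N : lmodType S) (u : {linear M -> N}) m :
  free_map u (free_gen S m) = free_gen S (u m).
Proof. exact: free_lift_gen. Qed.

Lemma free_cover_map (M N : lmodType S) (u : {linear M -> N}) w :
  free_cover N (free_map u w) = u (free_cover M w).
Proof.
apply: (free_ext (f := free_cover N \o free_map u) (g := u \o free_cover M)).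
by move=> m; rewrite /= !free_lift_gen.
Qed.

Lemma free_map_cancel (M N : lmodType S) (u : {linear M -> N})
    (v : {linear N -> M}) (w : {malg S[M]}) :
  {in msupp w, cancel u v} -> free_map v (free_map u w) = w.
Proof.
move=> uvK; rewrite [RHS]free_genE [X in free_map u X]free_genE.
rewrite (linear_sum (free_map u)) (linear_sum (free_map v)) big_seq [RHS]big_seq.
apply: eq_bigr => m /uvK vuK.
by rewrite (linearZ_LR (free_map u)) (linearZ_LR (free_map v)) !free_map_gen vuK.
Qed.

Lemma syzygy_map (M N : lmodType S) (u : {linear M -> N}) :
  exists u' : {linear ker (free_cover M) -> ker (free_cover N)},
    forall x, \val (u' x) = free_map u (\val x).
Proof.
apply: (factor_ker (t := free_map u \o \val)) => x.
by rewrite /= free_cover_map [free_cover M _]ker_valK linear0.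
Qed.

(** An element of a free module on Q involves finitely many elements of Q, so the
local factorizations of Q induce ones on its syzygy. *)
Lemma acyclic_upto_local n (Q : lmodType S) :
  locally_acyclic_upto n Q -> acyclic_upto n Q.
Proof.
elim: n Q => [//|n IH] Q lQ; apply/acyclic_uptoS; split.
  move=> z dz; have [M [u [v [/acyclic_uptoS [tM _] uvK]]]] := lQ (msupp (\val z)).
  have [u' u'E] := syzygy_map u; have [v' v'E] := syzygy_map v.
  have -> : z = v' (u' z).
    by apply: val_inj; rewrite v'E u'E free_map_cancel.
  by apply/decomposable_linear/tM; rewrite u'E; exact: decomposable_linear.
apply: IH => s.
have [M [u [v [/acyclic_uptoS [_ aM] uvK]]]] :=
  lQ (flatten [seq (msupp (\val z) : seq Q) | z <- s]).
have [u' u'E] := syzygy_map u; have [v' v'E] := syzygy_map v.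
exists (ker (free_cover M)), u', v'; split=> // z zs.
apply: val_inj; rewrite v'E u'E free_map_cancel // => q qz.
by apply: uvK; apply/flatten_mapP; exists z.
Qed.

Lemma acyclic_local (Q : lmodType S) :
  (forall s : seq Q, exists (M : lmodType S) (u : {linear Q -> M})
    (v : {linear M -> Q}), acyclic M /\ {in s, cancel u v}) -> acyclic Q.
Proof.
move=> lQ; split=> [x|n].
  have [M [u [v [[dM _] uvK]]]] := lQ [:: x].
  by rewrite -(uvK x (mem_head _ _)); exact/decomposable_linear/dM.
apply: acyclic_upto_local => s; have [M [u [v [[_ aM] uvK]]]] := lQ s.
by exists M, u, v.
Qed.

Lemma acyclic_prod (M N : lmodType S) :
  acyclic M -> acyclic N -> acyclic (M * N)%type.
Proof.
move=> [dM aM] [dN aN]; split=> [[x y]|n]; last exact: acyclic_upto_prod.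
have -> : (x, y) = inj_left x + inj_right y.
  by congr pair; rewrite /= ?addr0 ?add0r.
by apply: decomposableD; apply: decomposable_linear.
Qed.

(** The composites of u j and v j stand for the projections of a direct sum of
copies of M.  Finitely many of them add up to an endomorphism that fixes given
elements and factors through a finite power of M. *)
Lemma acyclic_direct_sum (M Q : lmodType S) (J : eqType)
    (u : J -> {linear Q -> M}) (v : J -> {linear M -> Q}) :
  acyclic M ->
  (forall x, exists s : seq J, forall s', uniq s' -> {subset s <= s'} ->
     x = \sum_(j <- s') v j (u j x)) ->
  acyclic Q.
Proof.
move=> aM decQ; apply: acyclic_local => s.
have fin (l : seq J) : exists (N : lmodType S) (u' : {linear Q -> N})
    (v' : {linear N -> Q}),
    acyclic N /\ forall x, v' (u' x) = \sum_(j <- l) v j (u j x).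
  elim: l => [|j l [N [u' [v' [aN vuE]]]]].
    by exists M, \0, \0; split=> // x; rewrite big_nil.
  have w_lin : linear (fun x => (u j x, u' x)) by move=> k x y; rewrite !linearP.
  exists (M * N)%type, (make_linear w_lin), ((v j \o fst) \+ (v' \o snd)).
  by split=> [|x]; [exact: acyclic_prod | rewrite big_cons -vuE].
have [l lE] : exists l : seq J, forall x, x \in s -> forall s', uniq s' ->
    {subset l <= s'} -> x = \sum_(j <- s') v j (u j x).
  elim: s => [|x s [l lE]]; first by exists [::].
  have [l' l'E] := decQ x; exists (l' ++ l) => y ys s' us' ss'.
  move: ys; rewrite inE => /predU1P [->|ys].
    by apply: l'E => // j jl; apply: ss'; rewrite mem_cat jl.
  by apply: lE => // j jl; apply: ss'; rewrite mem_cat jl orbT.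
have [N [u' [v' [aN vuE]]]] := fin (undup l).
exists N, u', v'; split=> // x xs; rewrite vuE.
rewrite -(lE x xs (undup l)) ?undup_uniq // => j.
by rewrite mem_undup.
Qed.

End Decomposable.

(** * Tor with coefficients in the augmentation module *)

Lemma free_gen_intE (X : choiceType) (x : {malg int[X]}) :
  x = \sum_(k <- msupp x) free_gen int k *~ x@_k.
Proof.
by rewrite [LHS]free_genE; apply: eq_bigr => k _; rewrite -scaler_int intz.
Qed.

Lemma additive_ext (X : choiceType) (V : zmodType)
    (f g : {additive {malg int[X]} -> V}) :
  (forall k, f (free_gen int k) = g (free_gen int k)) -> f =1 g.
Proof.
move=> fg x; rewrite (free_gen_intE x) (raddf_sum f) (raddf_sum g).
by apply: eq_bigr => k _; rewrite (raddfMz f) (raddfMz g) fg.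
Qed.

Definition augmentation_zero (R : rngType) (s : (unitization R)^c) : Prop :=
  s.2 = 0.

Lemma unitization_int (R : rngType) (k : int) : k%:~R = (0, k) :> unitization R.
Proof.
elim/int_rec: k => [|k IH|k IH]; first by rewrite mulr0z.
  rewrite -addn1 PoszD intrD IH; congr pair; first exact: addr0.
rewrite -addn1 PoszD opprD intrD IH mulrN1z; congr pair.
by rewrite /= oppr0 addr0.
Qed.

Lemma unitization_scale (R : rngType) (M : lmodType (unitization R)^c)
    (s : (unitization R)^c) (m : M) :
  s *: m = ((s.1, 0) : (unitization R)^c) *: m + m *~ s.2.
Proof.
rewrite -scaler_int -scalerDl; congr (_ *: _).
have -> : s.2%:~R = (0, s.2) :> (unitization R)^c by exact: unitization_int.
by case: s => r k; congr pair; rewrite ?addr0 ?add0r.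
Qed.

Section TensorAug.
Variables (R : rngType) (M : lmodType (unitization R)^c).
Local Notation Rt := (unitization R).
Local Notation dec := (decomposable (@augmentation_zero R)).
Local Notation gen := (generated (@tensor_rel Rt M (aug_int R))).

Lemma generatedN (A : zmodType) (X : A -> Prop) x :
  generated X x -> generated X (- x).
Proof. by rewrite -sub0r => gx; apply: Gen_sub => //; exact: Gen_0. Qed.

Lemma generatedD (A : zmodType) (X : A -> Prop) x y :
  generated X x -> generated X y -> generated X (x + y).
Proof. by move=> gx gy; rewrite -[y]opprK; apply: Gen_sub => //; exact: generatedN. Qed.

Lemma generatedZ (A : zmodType) (X : A -> Prop) x (n : int) :
  generated X x -> generated X (x *~ n).
Proof.
move=> gx; elim/int_rec: n => [|n IH|n IH].
- by rewrite mulr0z; exact: Gen_0.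
- by rewrite -addn1 PoszD mulrzDr; exact: generatedD.
by rewrite -addn1 PoszD opprD mulrzDr mulrN1z; exact: Gen_sub.
Qed.

(** The map M (x) Z -> M / M.R, m (x) n |-> n m, before passing to quotients. *)
Definition tensor_value : {malg int[(M * aug_int R)%type]} -> M :=
  free_lift (M := zmodule M) (fun k => (k.1 : M) *~ k.2).

Fact tensor_value_is_zmod_morphism : zmod_morphism tensor_value.
Proof. exact: (raddfB (free_lift (M := zmodule M) (fun k => (k.1 : M) *~ k.2))). Qed.

HB.instance Definition _ := GRing.isZmodMorphism.Build
  {malg int[(M * aug_int R)%type]} M tensor_value tensor_value_is_zmod_morphism.

Lemma tensor_value_gen m n : tensor_value (free_gen int (m, n)) = m *~ n.
Proof.
exact: (free_lift_gen (M := zmodule M)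
  (fun k : M * aug_int R => (k.1 : M) *~ k.2) (m, n)).
Qed.

Lemma tensor_value_rel x : gen x -> dec (tensor_value x).
Proof.
elim=> {x} [x []| |x y _ dx _ dy].
- move=> m1 m2 n; rewrite !raddfB /= !tensor_value_gen mulrzDl.
  by rewrite addrAC addrK subrr; constructor.
- move=> m n1 n2; rewrite !raddfB /= !tensor_value_gen.
  by rewrite mulrzDr addrAC addrK subrr; constructor.
- move=> s m n; rewrite !raddfB /= !tensor_value_gen.
  rewrite unitization_scale mulrzDl mulrzA addrK -scaler_int scalerA.
  by apply: decomposableZ; exact: mul0r.
- by rewrite raddf0; constructor.
- by rewrite raddfB; apply/decomposableD/decomposableN.
Qed.

Local Notation e m := (free_gen int ((m, 1) : M * aug_int R)).

Lemma gen_unitD m1 m2 : gen (e (m1 + m2) - e m1 - e m2).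
Proof. by apply: Gen_in; exact: (Tensor_Dl (N := aug_int R)). Qed.

Lemma gen_unit0 : gen (e 0).
Proof.
rewrite -[e 0]opprK; apply: generatedN.
by have := gen_unitD 0 0; rewrite addr0 subrr sub0r.
Qed.

Lemma gen_decomposable m : dec m -> gen (e m).
Proof.
elim=> [|s {}m y s0 _ gy]; first exact: gen_unit0.
have gs : gen (e (s *: m)).
  have gm0 : gen (free_gen int ((m, 0) : M * aug_int R)).
    rewrite -[free_gen _ _]opprK; apply: generatedN.
    have := Gen_in (Tensor_Dr m (0 : aug_int R) 0).
    by rewrite addr0 subrr sub0r.
  have := generatedD (Gen_in (Tensor_bal (s : Rt) m (1 : aug_int R))) gm0.
  have -> : (s : Rt) *: (1 : aug_int R) = 0.
    by rewrite -[LHS]/(s.2 * 1 : int) s0 mul0r.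
  by rewrite subrK.
by have := generatedD (generatedD (gen_unitD (s *: m) y) gy) gs; rewrite !subrK.
Qed.

(** Modulo the tensor relations, a formal sum reduces to a single pair (m, 1); the
elements for which it does form a subgroup containing the generators. *)
Lemma gen_tensor_value x : gen (x - e (tensor_value x)).
Proof.
pose Q (x : {malg int[(M * aug_int R)%type]}) := gen (x - e (tensor_value x)).
have QB y z : Q y -> Q z -> Q (y - z).
  have -> : Q (y - z) =
      gen (y - z - e (tensor_value y - tensor_value z)) by rewrite /Q raddfB.
  rewrite /Q; move: (tensor_value y) (tensor_value z) => a b qy qz.
  have := generatedD (Gen_sub qy qz) (gen_unitD (a - b) b); rewrite subrK.
  by rewrite opprB [X in gen X](AC (2*2*3) (1*4*6*(5*2)*(3*7))) /= !subrr !addr0.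
have genQ y : generated Q y -> Q y.
  elim=> // [|{}y z _ Qy _ Qz]; last exact: QB.
  by rewrite /Q raddf0 sub0r; apply/generatedN/gen_unit0.
apply: genQ; rewrite (free_gen_intE x); elim/big_ind: _ => [||k _]; first exact: Gen_0.
  exact: generatedD.
apply/generatedZ/Gen_in; case: k => m n; rewrite /Q tensor_value_gen.
have := Gen_in (Tensor_bal ((0, n) : Rt) m (1 : aug_int R)).
have -> : (((0, n) : Rt) : Rt^c) *: m = m *~ n.
  rewrite unitization_scale -[RHS]add0r; congr (_ + _).
  exact: (scale0r (m : M)).
have -> : ((0, n) : Rt) *: (1 : aug_int R) = n by exact: mulr1.
by move=> /generatedN; rewrite opprB.
Qed.

(** M (x) Z = M / M.R. *)
Lemma gen_tensorP x : gen x <-> dec (tensor_value x).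
Proof.
split=> [|dx]; first exact: tensor_value_rel.
by rewrite -[x](subrK (e (tensor_value x))); apply: generatedD;
  [exact: gen_tensor_value | exact: gen_decomposable].
Qed.

End TensorAug.

Section Vanishing.

Lemma quotient_by_eq0 (A : zmodType) (X : A -> Prop) (x : A) :
  \pi_(quotient_by X)%qT x = 0 <-> generated X x.
Proof.
have pi0 : \pi_(quotient_by X)%qT (0 : A) = 0 by exact: raddf0.
rewrite -pi0; split=> [/eqP|gx].
  by rewrite -Quotient.idealrBE subr0 => /asboolP.
by apply/eqP; rewrite -Quotient.idealrBE subr0; apply/asboolP.
Qed.

Lemma homology_eq0 (A B C : zmodType) (f : {additive A -> B})
    (g : {additive B -> C}) :
  (forall x : homology f g, x = 0) <->
  (forall z, g z = 0 -> exists a, f a = z).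
Proof.
split=> [H0 z gz|ex x].
  have kz : z \in ker_pred g by exact/eqP.
  have /quotient_by_eq0 := H0 (\pi_(homology f g)%qT (Ker kz)).
  rewrite -[z]/(\val (Ker kz)); elim=> {z gz kz} [//||x y _ [a aE] _ [b bE]].
    by exists 0; rewrite !raddf0.
  by exists (a - b); rewrite !raddfB aE bE.
rewrite -[x]reprK; apply/quotient_by_eq0/Gen_in.
by apply: ex; exact: (eqP (valP (repr x))).
Qed.

Variable R : rngType.
Implicit Types A B C : lmodType (unitization R)^c.
Local Notation dec := (decomposable (@augmentation_zero R)).
Local Notation tight := (tight (@augmentation_zero R)).
Local Notation T := (fun B => tensor B (aug_int R)).

Lemma tensor_value_map A B (f : {linear A -> B}) x :
  tensor_value (tensor_map_free f x) = f (tensor_value x).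
Proof.
apply: (additive_ext (f := tensor_value (M := B) \o tensor_map_free f)
  (g := f \o tensor_value (M := A))) => -[m n].
by rewrite /= tensor_map_free_gen !tensor_value_gen raddfMz.
Qed.

Lemma tensor_pi_eq0 B x :
  \pi_(tensor B (aug_int R))%qT x = 0 <-> dec (tensor_value x).
Proof. by rewrite quotient_by_eq0 gen_tensorP. Qed.

Lemma tensor_value_unit B (m : B) :
  tensor_value (free_gen int ((m, 1) : B * aug_int R)) = m.
Proof. by rewrite tensor_value_gen mulr1z. Qed.

(** Every element of B (x) Z is of the form w (x) 1, so exactness after tensoring
with Z can be expressed on elements w of B. *)
Lemma tensor_exact A B (f : {linear A -> B}) (P : T B -> Prop) :
  (forall z, P z -> exists a, tensor_map (aug_int R) f a = z) <->
  (forall w : B, P (\pi_(tensor B (aug_int R))%qT (free_gen int (w, 1))) ->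
     exists v, dec (f v - w)).
Proof.
split=> [ex w Pw|ex z Pz].
  have [a aE] := ex _ Pw; exists (tensor_value (repr a)).
  have /eqP := aE; rewrite -[a]reprK tensor_map_pi -subr_eq0 -raddfB.
  move=> /eqP/tensor_pi_eq0.
  by rewrite raddfB /= tensor_value_map reprK tensor_value_unit.
have zE : \pi_(tensor B (aug_int R))%qT
    (free_gen int (tensor_value (repr z), 1)) = z.
  rewrite -[RHS]reprK; apply/eqP; rewrite eq_sym -subr_eq0 -raddfB.
  apply/eqP/tensor_pi_eq0.
  by rewrite raddfB /= tensor_value_unit subrr; constructor.
have [v vE] := ex (tensor_value (repr z)) (ltac:(rewrite zE; exact: Pz)).
exists (\pi_(tensor A (aug_int R))%qT (free_gen int (v, 1))).
rewrite -zE tensor_map_pi; apply/eqP; rewrite -subr_eq0 -raddfB; apply/eqP/tensor_pi_eq0.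
by rewrite raddfB /= tensor_value_map !tensor_value_unit.
Qed.

(** For A -> B -> C -> 0 exact, this is the right exactness of M |-> M / M.R: the
quotient of B / B.R by the image of A is C / C.R. *)
Lemma decomposable_mod_image A B C (f : {linear A -> B}) (c : {linear B -> C}) w :
  (forall x, exists y, c y = x) -> (forall x, c x = 0 <-> exists y, f y = x) ->
  (exists v, dec (f v - w)) <-> dec (c w).
Proof.
move=> c_surj ex; split=> [[v dv]|dcw].
  have -> : c w = - c (f v - w).
    by rewrite linearB (_ : c (f v) = 0) ?sub0r ?opprK //; apply/ex; exists v.
  exact/decomposableN/decomposable_linear.
have [w' dw' w'E] := decomposable_lift c_surj dcw.
have [v vE] : exists v, f v = w - w' by apply/ex; rewrite linearB w'E subrr.
by exists v; rewrite vE addrAC subrr sub0r; exact: decomposableN.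
Qed.

Lemma Tor0_eq0 (M : lmodType (unitization R)^c) :
  (forall x : Tor M (aug_int R) 0, x = 0) <-> (forall m : M, dec m).
Proof.
rewrite homology_eq0.
rewrite (tensor_exact (std_res_d M 0) (fun z => (\0 : _ -> int) z = 0)).
have critE w := @decomposable_mod_image _ _ _ (std_res_d M 0) (free_cover M) w
  (@free_cover_surj _ M) (@std_res_exact0 _ M).
split=> [ex m|dM w _]; last exact/critE/dM.
by have [w <-] := free_cover_surj m; apply/critE/ex.
Qed.

Lemma TorS_eq0 (M : lmodType (unitization R)^c) n :
  (forall x : Tor M (aug_int R) n.+1, x = 0) <-> tight (free_cover (syzygy M n)).
Proof.
rewrite homology_eq0.
rewrite (tensor_exact (std_res_d M n.+1)
  (fun z => tensor_map (aug_int R) (std_res_d M n) z = 0)).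
have ex1 x : free_cover (syzygy M n.+1) x = 0 <->
    exists y, std_res_d M n.+1 y = x.
  rewrite -std_res_exact; split=> x0; first exact: (congr1 val x0).
  by apply: val_inj; exact: x0.
have critE w := @decomposable_mod_image _ _ _ (std_res_d M n.+1)
  (free_cover (syzygy M n.+1)) w (@free_cover_surj _ (syzygy M n.+1)) ex1.
have cycleE w : tensor_map (aug_int R) (std_res_d M n)
    (\pi_(tensor (std_res M n.+1) (aug_int R))%qT (free_gen int (w, 1))) = 0 <->
    dec (\val (free_cover (syzygy M n.+1) w)).
  by rewrite tensor_map_pi tensor_pi_eq0 tensor_value_map tensor_value_unit.
split=> [ex z dz|t w /cycleE dw]; last exact/critE/t.
by have [w wE] := free_cover_surj (M := syzygy M n.+1) z; rewrite -wE;
  apply/critE/ex/cycleE; rewrite wE.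
Qed.

Lemma Hprime_unitalP :
  Hprime_unital R <-> acyclic (@augmentation_zero R) (right_self R).
Proof.
split=> [H|[dR aR] [|n]].
- split; first by apply/Tor0_eq0 => x; exact: H.
  by move=> n i _; apply/TorS_eq0 => x; exact: H.
- exact/Tor0_eq0.
- by apply/TorS_eq0; exact: (aR n.+1).
Qed.

End Vanishing.

(** * Change of rings *)

Definition restrict (S T : nzRingType) (_ : {rmorphism S -> T}) (N : lmodType T) :
  Type := N.

Section Restriction.
Variables (S T : nzRingType) (rho : {rmorphism S -> T}).
Local Notation restrict := (restrict rho).

Section Module.
Variable N : lmodType T.

HB.instance Definition _ := GRing.Zmodule.on (restrict N).

Definition restrict_scale (a : S) (x : restrict N) : restrict N :=
  rho a *: (x : N).

Fact restrict_scaleA a b x :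
  restrict_scale a (restrict_scale b x) = restrict_scale (a * b) x.
Proof. by rewrite /restrict_scale scalerA rmorphM. Qed.

Fact restrict_scale1 : left_id 1 restrict_scale.
Proof. by move=> x; rewrite /restrict_scale rmorph1 scale1r. Qed.

Fact restrict_scaleDr : right_distributive restrict_scale +%R.
Proof. by move=> a x y; exact: scalerDr. Qed.

Fact restrict_scaleDl x : {morph restrict_scale^~ x : a b / a + b}.
Proof. by move=> a b; rewrite /restrict_scale rmorphD scalerDl. Qed.

HB.instance Definition _ := GRing.Zmodule_isLmodule.Build S (restrict N)
  restrict_scaleA restrict_scale1 restrict_scaleDr restrict_scaleDl.
End Module.

Section Map.
Variables (M N : lmodType T) (f : {linear M -> N}).

Fact restrict_map_linear : linear (fun x : restrict M => f x : restrict N).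
Proof. by move=> a x y; exact: linearP. Qed.

Definition restrict_map : {linear restrict M -> restrict N} :=
  make_linear restrict_map_linear.
Lemma restrict_mapE x : restrict_map x = f x. Proof. by []. Qed.
End Map.

Lemma decomposable_restrict (I : S -> Prop) (J : T -> Prop) (N : lmodType T)
    (x : restrict N) :
  (forall a, I a -> J (rho a)) -> decomposable I x -> decomposable J (x : N).
Proof.
move=> IJ; elim=> [|a m {}x Ia _ IH]; first exact: decomposable0.
by apply: decomposable_cons IH; exact: IJ.
Qed.

End Restriction.

(** The absorption hypothesis is an argument so that the submodule structure can be
inferred from the predicate. *)
Definition decomposable_pred (T : nzRingType) (J : T -> Prop)
    (_ : forall a s, J s -> J (a * s)) (M : lmodType T) : {pred M} :=
  [pred x | `[< decomposable J x >]].
Arguments decomposable_pred {T J} _ M _.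

Section DecomposableSubmodule.
Variables (T : nzRingType) (J : T -> Prop).
Hypothesis J_ideal : forall a s, J s -> J (a * s).

Section Module.
Variable M : lmodType T.
Local Notation P := (decomposable_pred J_ideal M).

Lemma decomposable_predP x : reflect (decomposable J x) (x \in P).
Proof. exact: asboolP. Qed.

Fact decomposable_pred_zmod_closed : zmod_closed P.
Proof.
split=> [|x y /decomposable_predP dx /decomposable_predP dy].
  by apply/decomposable_predP; constructor.
exact/decomposable_predP/decomposableD/decomposableN.
Qed.

HB.instance Definition _ := GRing.isZmodClosed.Build M P
  decomposable_pred_zmod_closed.

Fact decomposable_pred_scaler_closed : scaler_closed P.
Proof.
move=> a x /decomposable_predP dx; apply/decomposable_predP.
elim: dx => [|s m {}x Js _ IH]; first by rewrite scaler0; constructor.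
by rewrite scalerDr scalerA; constructor=> //; exact: J_ideal.
Qed.

HB.instance Definition _ := GRing.isScaleClosed.Build T M P
  decomposable_pred_scaler_closed.

Record decomposable_part := DecomposablePart
  { decomposable_val : M; _ : decomposable_val \in P }.

HB.instance Definition _ := [isSub for decomposable_val].
HB.instance Definition _ := [Choice of decomposable_part by <:].
HB.instance Definition _ := [SubChoice_isSubZmodule of decomposable_part by <:].
HB.instance Definition _ := [SubZmodule_isSubLmodule of decomposable_part by <:].

Lemma decomposable_part_val (x : decomposable_part) : decomposable J (\val x).
Proof. exact/decomposable_predP/(valP x). Qed.

Lemma factor_decomposable (N : lmodType T) (t : {linear N -> M}) :
  (forall x, decomposable J (t x)) ->
  exists c : {linear N -> decomposable_part}, forall x, \val (c x) = t x.
Proof.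
move=> dt; apply: factor_through => [|x]; first exact: val_inj.
have kx : t x \in P by exact/decomposable_predP.
by exists (DecomposablePart kx).
Qed.

End Module.
End DecomposableSubmodule.

Section ChangeOfRings.
Variables (S T : nzRingType) (rho : {rmorphism S -> T}).
Variables (I : S -> Prop) (J : T -> Prop).
Hypothesis J_ideal : forall a s, J s -> J (a * s).
Hypothesis rhoIJ : forall a, I a -> J (rho a).
Local Notation part M := (decomposable_part J_ideal M).
Local Notation res := (restrict rho).
Hypothesis free_part_acyclic : forall X : choiceType,
  acyclic I (res (part {malg T[X]})).

Lemma acyclic_iso (M N : lmodType S) (i : {linear M -> N}) (p : {linear N -> M}) :
  cancel i p -> acyclic I N -> acyclic I M.
Proof.
move=> ipK [dN aN]; split=> [x|n].
  by rewrite -[x]ipK; apply: decomposable_linear.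
exact: acyclic_upto_retract (retract_section ipK) (aN n).
Qed.

(** With K the kernel of F.J -> P.J for the free cover F of P: as a kernel of a
surjection between modules acyclic over S, K is acyclic, so every element of K
is decomposable in K.  Hence K is also J.ker(F -> P). *)
Lemma restrict_syzygy (P : lmodType T) : acyclic I (res (part P)) ->
  tight J (free_cover P) /\ acyclic I (res (part (ker (free_cover P)))).
Proof.
move=> aP; pose c := free_cover P; pose F := part {malg T[P]}.
have [q qE] : exists q : {linear F -> part P}, forall x, \val (q x) = c (\val x).
  apply: (factor_decomposable J_ideal (t := c \o \val)) => x.
  exact/(decomposable_linear c)/decomposable_part_val.
have aK : acyclic I (res (ker q)).
  apply: (acyclic_sub (i := restrict_map rho (\val : {linear ker q -> F}))
    (p := restrict_map rho q) _ _ _ (free_part_acyclic P) aP).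
  - exact: val_inj.
  - move=> x; split=> [qx0|[k <-]]; last exact: (ker_valK k).
    have kx : x \in ker_pred q by exact/eqP.
    by exists (Ker kx).
  - move=> y; have [x dx xE] := decomposable_lift (@free_cover_surj T P)
      (decomposable_part_val y).
    have kx : x \in decomposable_pred J_ideal {malg T[P]} by exact/decomposable_predP.
    exists (DecomposablePart kx : F); apply: val_inj; rewrite restrict_mapE qE.
    exact: xE.
have dK (x : ker q) : decomposable J x by exact: decomposable_restrict (aK.1 x).
have [e eE] : exists e : {linear ker q -> ker c}, forall x, \val (e x) = \val (\val x).
  apply: (factor_ker (t := \val \o \val)) => x.
  by rewrite /= -[c _]qE; rewrite [q _]ker_valK.
split=> [z dz|].
  have kz : \val z \in decomposable_pred J_ideal {malg T[P]} by exact/decomposable_predP.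
  have qz : (DecomposablePart kz : F) \in ker_pred q.
    by apply/eqP/val_inj; rewrite qE; exact: (ker_valK z).
  have -> : z = e (Ker qz) by apply: val_inj; rewrite eE.
  exact: decomposable_linear.
have [d dE] : exists d : {linear part (ker c) -> F}, forall x, \val (d x) = \val (\val x).
  apply: (factor_decomposable J_ideal (t := \val \o \val)) => x.
  exact/(decomposable_linear \val)/decomposable_part_val.
have [d' d'E] : exists d' : {linear part (ker c) -> ker q}, forall x, \val (d' x) = d x.
  apply: (factor_ker (t := d)) => x.
  by apply: val_inj; rewrite qE dE; exact: (ker_valK (\val x)).
have [e' e'E] : exists e' : {linear ker q -> part (ker c)}, forall x, \val (e' x) = e x.
  by apply: (factor_decomposable J_ideal (t := e)) => x; exact: decomposable_linear.
apply: (acyclic_iso (i := restrict_map rho d') (p := restrict_map rho e')) aK => x.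
rewrite !restrict_mapE; apply: val_inj; rewrite e'E; apply: val_inj.
by rewrite eE d'E dE.
Qed.

Lemma acyclic_change_of_rings (P : lmodType T) :
  acyclic I (res (part P)) -> forall n, acyclic_upto J n P.
Proof.
move=> aP n; elim: n P aP => [//|n IH] P /restrict_syzygy [tP aK].
by apply/acyclic_uptoS; split; [|exact: IH].
Qed.

End ChangeOfRings.

(** * Extensions of rings without unit *)

Lemma augmentation_zeroM (R : rngType) (a s : (unitization R)^c) :
  augmentation_zero s -> augmentation_zero (a * s).
Proof. by move=> s0; rewrite /augmentation_zero /= s0 mul0r. Qed.

Section FreeDecomposable.
Variables (R : rngType) (X : choiceType).
Local Notation T := (unitization R)^c.
Local Notation part := (decomposable_part (@augmentation_zeroM R)).

Lemma decomposable_coef (y : {malg T[X]}) x :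
  decomposable (@augmentation_zero R) y -> (y@_x).2 = 0.
Proof.
elim=> [|s m {}y s0 _ IH]; first by rewrite mcoeff0.
rewrite mcoeffD mcoeffZ /= IH addr0.
by rewrite -[LHS]/((m@_x).2 * s.2) s0 mulr0.
Qed.

Fact free_part_coef_linear x :
  linear (fun y : part {malg T[X]} => ((\val y)@_x).1 : right_self R).
Proof.
move=> [r k] y z; rewrite linearP mcoeffD mcoeffZ.
have := decomposable_coef x (decomposable_part_val y).
case: ((\val y)@_x) => a n /= ->.
by rewrite -[LHS]/(a ** r + r *~ 0 + a *~ k + _) mulr0z addr0.
Qed.

Fact free_part_gen_subproof x (a : right_self R) :
  ((a, 0) : T) *: free_gen T x
    \in decomposable_pred (@augmentation_zeroM R) {malg T[X]}.
Proof. by apply/decomposable_predP; exact: decomposableZ. Qed.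

Fact free_part_gen_linear x :
  linear (fun a : right_self R =>
    DecomposablePart (free_part_gen_subproof x a) : part {malg T[X]}).
Proof.
move=> [r k] a b; apply: val_inj; rewrite linearP /= scalerA -scalerDl.
congr (_ *: _); congr pair; last first.
  by rewrite -[RHS]/(0 * k + 0) mul0r addr0.
by rewrite -[RHS]/(a ** r + r *~ 0 + a *~ k + _) mulr0z addr0.
Qed.

(** If F is free over the unitization, then F.R is the direct sum of copies of R. *)
Lemma acyclic_free_part (S : nzRingType) (rho : {rmorphism S -> T})
    (I : S -> Prop) :
  acyclic I (restrict rho (right_self R)) ->
  acyclic I (restrict rho (part {malg T[X]})).
Proof.
move=> aR; apply: (acyclic_direct_sum (J := X)
  (u := fun x => restrict_map rho (make_linear (free_part_coef_linear x)))
  (v := fun x => restrict_map rho (make_linear (free_part_gen_linear x))) aR).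
move=> y; exists (msupp (\val (y : part _))) => s us ss.
apply: val_inj; transitivity (\sum_(x <- s) (\val (y : part _))@_x *: free_gen T x).
  rewrite [LHS]free_genE; apply/perm_big_supp/uniq_perm; rewrite ?filter_uniq // => x.
  rewrite !mem_filter; have [xy|xy] := boolP (x \in msupp (\val (y : part _))).
    by rewrite ss.
  by rewrite (mcoeff_outdom xy) scale0r eqxx.
rewrite [RHS](raddf_sum (\val : {additive part {malg T[X]} -> _})).
apply: eq_bigr => x _.
have y0 := decomposable_coef x (decomposable_part_val (y : part _)).
rewrite -[RHS]/(((((\val (y : part _))@_x).1, 0) : T) *: free_gen T x) -y0.
by rewrite -surjective_pairing.
Qed.

End FreeDecomposable.

Section RngExtension.
Variables (R A : rngType) (iota : {additive R -> A}).
Hypothesis iotaM : {morph iota : x y / x ** y}.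

Definition unitization_map (a : (unitization R)^c) : (unitization A)^c :=
  (iota a.1, a.2).

Fact unitization_map_zmod_morphism : zmod_morphism unitization_map.
Proof. by move=> [a m] [b n]; congr pair; rewrite /= raddfB. Qed.

Fact unitization_map_monoid_morphism : monoid_morphism unitization_map.
Proof.
split=> [|[a m] [b n]]; first by congr pair; exact: raddf0.
by congr pair; rewrite /= !raddfD !raddfMz iotaM.
Qed.

HB.instance Definition _ := GRing.isZmodMorphism.Build _ _ unitization_map
  unitization_map_zmod_morphism.
HB.instance Definition _ := GRing.isMonoidMorphism.Build _ _ unitization_map
  unitization_map_monoid_morphism.

Lemma Hprime_unital_of_acyclic :
  acyclic (@augmentation_zero R) (restrict unitization_map (right_self A)) ->
  Hprime_unital A.
Proof.
move=> aA; apply/Hprime_unitalP.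
have dA (x : right_self A) : decomposable (@augmentation_zero A) x.
  by apply: decomposable_restrict (aA.1 x).
split=> // n; apply: (acyclic_change_of_rings (J_ideal := @augmentation_zeroM A)
  (rho := unitization_map) (I := @augmentation_zero R)) => //.
  by move=> X; exact: acyclic_free_part.
have [c cE] := factor_decomposable (@augmentation_zeroM A) (t := idfun) dA.
apply: (acyclic_iso (i := restrict_map unitization_map
    (\val : {linear decomposable_part (@augmentation_zeroM A) (right_self A) -> _}))
  (p := restrict_map unitization_map c)) aA => x.
by apply: val_inj; rewrite !restrict_mapE cE.
Qed.

(** When A is a direct sum of copies of R as a right R-module, u e and v e are the
projection onto the summand of index e and its inclusion. *)
Lemma Hprime_unital_extension (E : eqType) (u : E -> {additive A -> R})
    (v : E -> {additive R -> A}) :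
  (forall e a r, u e (a ** iota r) = u e a ** r) ->
  (forall e x r, v e (x ** r) = v e x ** iota r) ->
  (forall a, exists s : seq E, forall s', uniq s' -> {subset s <= s'} ->
     a = \sum_(e <- s') v e (u e a)) ->
  Hprime_unital R -> Hprime_unital A.
Proof.
move=> uM vM decA /Hprime_unitalP aR; apply: Hprime_unital_of_acyclic.
have u_lin e : linear (fun a : restrict unitization_map (right_self A) =>
    u e a : right_self R).
  move=> [r k] a b; rewrite raddfD; congr (_ + _).
  by rewrite [LHS](raddfD (u e)) raddfMz uM.
have v_lin e : linear (fun x : right_self R =>
    v e x : restrict unitization_map (right_self A)).
  move=> [r k] x y; rewrite raddfD; congr (_ + _).
  by rewrite [LHS](raddfD (v e)) raddfMz vM.
exact: (acyclic_direct_sum (u := fun e => make_linear (u_lin e))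
  (v := fun e => make_linear (v_lin e)) aR decA).
Qed.

End RngExtension.

(** * Twisted polynomials and Laurent polynomials *)

(** A ring that is identified with the twisted sums by inverse bijections [coefs]
and [series], so as to treat both twisted rings at once. *)
Section TwistedRing.
Variables (R A : rngType) (E : nmodType) (act actV : E -> R -> R).
Hypothesis actD : forall m, {morph act m : x y / x + y}.
Hypothesis actM : forall m, {morph act m : x y / x ** y}.
Hypothesis act0 : act 0 =1 id.
Hypothesis actK : forall m, cancel (act m) (actV m).
Hypothesis actVK : forall m, cancel (actV m) (act m).

Variables (coefs : {additive A -> {malg R[E]}}) (series : {additive {malg R[E]} -> A}).
Hypothesis coefsK : cancel coefs series.
Hypothesis seriesK : cancel series coefs.
Hypothesis coefsM : forall a b, coefs (a ** b) = twisted_mul act (coefs a) (coefs b).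

Let actB m : zmod_morphism (act m).
Proof. by move=> x y; apply/eqP; rewrite eq_sym subr_eq -actD subrK. Qed.

Let actVM m : {morph actV m : x y / x ** y}.
Proof. by move=> x y; apply: (can_inj (@actK m)); rewrite actM !actVK. Qed.

Lemma twisted_mulU_coef g r m : (twisted_mul act g << r *g 0 >>)@_m = g@_m ** act m r.
Proof.
rewrite {1}(monalgE g).
have -> : twisted_mul act (\sum_(k <- msupp g) << g@_k *g k >>) << r *g 0 >> =
    \sum_(k <- msupp g) << g@_k ** act k r *g k >>.
  have mulD := twisted_mulDl actD.
  have mul0 : twisted_mul act 0 << r *g 0 >> = 0.
    by apply: (addrI (twisted_mul act 0 << r *g 0 >>)); rewrite -mulD !addr0.
  rewrite (big_morph (fun h => twisted_mul act h << r *g 0 >>)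
    (fun x y => mulD x y _) mul0).
  by apply: eq_bigr => k _; rewrite (twisted_mulUU actD) addr0.
rewrite raddf_sum /=; have [mg|mg] := boolP (m \in msupp g).
  rewrite (big_fsetD1 m) //= mcoeffUU big1_fset ?addr0 // => k.
  rewrite !inE => /andP [km _] _; rewrite mcoeffU (negPf km) //.
rewrite (mcoeff_outdom mg) rmul0l big1_fset // => k kg _.
rewrite mcoeffU; case: eqP => // km; by rewrite -km kg in mg.
Qed.

(** The right multiplication of a t^m by r is a phi^m(r) t^m, so the coefficients
have to be untwisted by phi^-m to become R-linear. *)
Lemma Hprime_unital_twisted : Hprime_unital R -> Hprime_unital A.
Proof.
have iotaB : zmod_morphism (fun r : R => series << r *g 0 >>).
  by move=> x y; rewrite monalgUB raddfB.
have uB m : zmod_morphism (fun a => actV m (coefs a)@_m).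
  move=> a b; apply: (can_inj (@actK m)).
  by rewrite actB !actVK raddfB mcoeffB.
have vB m : zmod_morphism (fun r => series << act m r *g m >>).
  by move=> x y; rewrite actB monalgUB raddfB.
pose iota := make_additive iotaB.
pose u m := make_additive (uB m).
pose v m := make_additive (vB m).
have mulUU := twisted_mulUU actD.
apply: (@Hprime_unital_extension R A iota _ E u v).
- move=> x y; apply: (can_inj coefsK).
  by rewrite coefsM /= !seriesK mulUU act0 addr0.
- move=> m a r; rewrite /u /iota !make_additiveE coefsM seriesK.
  by rewrite twisted_mulU_coef actVM actK.
- move=> m x r; apply: (can_inj coefsK).
  by rewrite coefsM /= !seriesK mulUU addr0 actM.
move=> a; exists (msupp (coefs a)) => s us ss.
rewrite -[LHS]coefsK {1}(monalgE (coefs a)) raddf_sum.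
have vuE m : v m (u m a) = series << (coefs a)@_m *g m >>.
  by rewrite /u /v !make_additiveE actVK.
rewrite (eq_bigr _ (fun m _ => vuE m)).
apply/perm_big_supp/uniq_perm; rewrite ?filter_uniq // => m.
rewrite !mem_filter; have [ma|ma] := boolP (m \in msupp (coefs a)).
  by rewrite ss.
by rewrite (mcoeff_outdom ma) monalgU0 raddf0 eqxx.
Qed.

End TwistedRing.

Lemma iter_cancel (X : Type) (f g : X -> X) m :
  cancel f g -> cancel (iter m f) (iter m g).
Proof. by move=> fK x; elim: m => // m IH; rewrite iterSr /= fK. Qed.

Theorem proposition2p8 (R : rngType) (phi : rng_aut R) :
  Hprime_unital R ->
  Hprime_unital (twisted_poly phi) /\ Hprime_unital (twisted_laurent phi).
Proof.
move=> RH; split.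
  apply: (@Hprime_unital_twisted R (twisted_poly phi) nat (aut_expn phi)
    (fun m => iter m (aut_inv phi)) _ _ _ _ _ idfun idfun _ _ _ RH) => // m.
  - exact: aut_expnD.
  - exact: aut_expnM.
  - exact: iter_cancel (aut_funK phi).
  - exact: iter_cancel (aut_invK phi).
have expzK m : cancel (aut_expz phi m) (aut_expz phi (- m)).
  by move=> x; rewrite -aut_expz_comp addNr.
apply: (@Hprime_unital_twisted R (twisted_laurent phi) int (aut_expz phi)
  (fun m => aut_expz phi (- m)) _ _ _ _ _ idfun idfun _ _ _ RH) => // m.
- exact: aut_expzD.
- exact: aut_expzM.
- by rewrite -{2}[m]opprK; exact: expzK.
Qed.
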